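(* Let $\mu_s=(a_s,b_s,c_s,d_s,e_s)$ with $a_s,b_s,c_s,d_s,e_s\in\mathbb R$, $b_s\neq 0$, $s=1,2$. Let $f\in L^1(\mathbb R^2,\mathbb H)$, let $\mathbf w_0=(u_0,v_0)\in\mathbb R^2$, and let $\mathcal M_{\mathbf w_0}f(\mathbf x)=e^{ix_1u_0}f(\mathbf x)e^{jx_2v_0}$. Then for all $\mathbf w=(w_1,w_2)\in\mathbb R^2$, $$\mathbb Q^{\mathbb H}_{\mu_1,\mu_2}[\mathcal M_{\mathbf w_0}f](\mathbf w)=e^{i\frac{c_1u_0^2-2b_1c_1u_0w_1-b_1e_1u_0}{b_1^2}}\;\mathbb Q^{\mathbb H}_{\mu_1,\mu_2}[f]\left(w_1-\frac{u_0}{b_1},\,w_2-\frac{v_0}{b_2}\right)\;e^{j\frac{c_2v_0^2-2b_2c_2v_0w_2-b_2e_2v_0}{b_2^2}}.$$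
   Context: $\mathbb H$ is the real quaternion algebra with imaginary units $i,j,k$. $L^p(\mathbb R^2,\mathbb H)$ is the space of $\mathbb H$-valued functions $f$ with $|f|\in L^p(\mathbb R^2)$. Two-sided quaternion quadratic-phase Fourier transform (Q-QPFT) of $f\in L^1(\mathbb R^2,\mathbb H)$: $$\mathbb Q^{\mathbb H}_{\mu_1,\mu_2}[f](\mathbf w)=\int_{\mathbb R^2}\Lambda^i_{\mu_1}(x_1,w_1)f(\mathbf x)\Lambda^j_{\mu_2}(x_2,w_2)\,d\mathbf x,$$ where $\Lambda^i_{\mu_1}(x_1,w_1)=\sqrt{\tfrac{b_1i}{2\pi}}\,e^{-i(a_1x_1^2+b_1x_1w_1+c_1w_1^2+d_1x_1+e_1w_1)}$ and $\Lambda^j_{\mu_2}(x_2,w_2)=\sqrt{\tfrac{b_2j}{2\pi}}\,e^{-j(a_2x_2^2+b_2x_2w_2+c_2w_2^2+d_2x_2+e_2w_2)}$. The square roots are principal square roots in the complex planes $\mathbb R+\mathbb R i$ and $\mathbb R+\mathbb R j$ respectively. *)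

(* Defs.v *)
From HB Require Import structures.
From mathcomp Require Import all_boot all_order all_algebra.
From mathcomp Require Import all_classical all_reals all_analysis.
From mathcomp Require Import complex ring.

Set Implicit Arguments.
Unset Strict Implicit.
Unset Printing Implicit Defensive.

Import Order.TTheory GRing.Theory Num.Theory.
Import numFieldNormedType.Exports.

Local Open Scope ring_scope.

(* Quat a b c d is a + b i + c j + d k. *)
Record quat (R : Type) := Quat { q0 : R; q1 : R; q2 : R; q3 : R }.

Section quaternion_ring.
Variable R : realType.
Implicit Types p q r : quat R.

Let to_tuple q := (q0 q, q1 q, q2 q, q3 q).
Let of_tuple (t : R * R * R * R) :=
  let: (a, b, c, d) := t in Quat a b c d.
Let to_tupleK : cancel to_tuple of_tuple. Proof. by case. Qed.

HB.instance Definition _ := Choice.copy (quat R) (can_type to_tupleK).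

Definition quat_add p q :=
  Quat (q0 p + q0 q) (q1 p + q1 q) (q2 p + q2 q) (q3 p + q3 q).
Definition quat_opp q := Quat (- q0 q) (- q1 q) (- q2 q) (- q3 q).
Definition quat_mul p q :=
  Quat (q0 p * q0 q - q1 p * q1 q - q2 p * q2 q - q3 p * q3 q)
       (q0 p * q1 q + q1 p * q0 q + q2 p * q3 q - q3 p * q2 q)
       (q0 p * q2 q - q1 p * q3 q + q2 p * q0 q + q3 p * q1 q)
       (q0 p * q3 q + q1 p * q2 q - q2 p * q1 q + q3 p * q0 q).

Let quat_addA : associative quat_add.
Proof. by case=> ? ? ? ? [? ? ? ?] [? ? ? ?]; congr Quat => /=; ring. Qed.

Let quat_addC : commutative quat_add.
Proof. by case=> ? ? ? ? [? ? ? ?]; congr Quat => /=; ring. Qed.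

Let quat_add0 : left_id (Quat 0 0 0 0) quat_add.
Proof. by case=> ? ? ? ?; congr Quat => /=; ring. Qed.

Let quat_addN : left_inverse (Quat 0 0 0 0) quat_opp quat_add.
Proof. by case=> ? ? ? ?; congr Quat => /=; ring. Qed.

HB.instance Definition _ := GRing.isZmodule.Build (quat R)
  quat_addA quat_addC quat_add0 quat_addN.

Let quat_mulA : associative quat_mul.
Proof. by case=> ? ? ? ? [? ? ? ?] [? ? ? ?]; congr Quat => /=; ring. Qed.

Let quat_mul1l : left_id (Quat 1 0 0 0) quat_mul.
Proof. by case=> ? ? ? ?; congr Quat => /=; ring. Qed.

Let quat_mul1r : right_id (Quat 1 0 0 0) quat_mul.
Proof. by case=> ? ? ? ?; congr Quat => /=; ring. Qed.

Let quat_mulDl : left_distributive quat_mul +%R.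
Proof. by case=> ? ? ? ? [? ? ? ?] [? ? ? ?]; congr Quat => /=; ring. Qed.

Let quat_mulDr : right_distributive quat_mul +%R.
Proof. by case=> ? ? ? ? [? ? ? ?] [? ? ? ?]; congr Quat => /=; ring. Qed.

Let quat_1neq0 : Quat 1 0 0 0 != 0 :> quat R.
Proof. by apply/eqP => -[] /eqP; rewrite oner_eq0. Qed.

HB.instance Definition _ := GRing.Zmodule_isNzRing.Build (quat R)
  quat_mulA quat_mul1l quat_mul1r quat_mulDl quat_mulDr quat_1neq0.

Definition qi : quat R := Quat 0 1 0 0.
Definition qj : quat R := Quat 0 0 1 0.
Definition qk : quat R := Quat 0 0 0 1.

Lemma qiM : qi * qi = -1. Proof. by congr Quat => /=; ring. Qed.
Lemma qjM : qj * qj = -1. Proof. by congr Quat => /=; ring. Qed.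
Lemma qkM : qk * qk = -1. Proof. by congr Quat => /=; ring. Qed.
Lemma qijk : qi * qj * qk = -1. Proof. by congr Quat => /=; ring. Qed.

Definition quat_norm q : R :=
  Num.sqrt (q0 q ^+ 2 + q1 q ^+ 2 + q2 q ^+ 2 + q3 q ^+ 2).

(* The complex planes R + R i and R + R j inside the quaternions. *)
Definition in_Ci (z : R[i]) : quat R := Quat (complex.Re z) (complex.Im z) 0 0.
Definition in_Cj (z : R[i]) : quat R := Quat (complex.Re z) 0 (complex.Im z) 0.

Definition cexpi (t : R) : R[i] := Complex (cos t) (sin t).

Definition qexpi (t : R) : quat R := in_Ci (cexpi t).
Definition qexpj (t : R) : quat R := in_Cj (cexpi t).

End quaternion_ring.

Section plane.
Variable R : realType.

Notation borel_measure2 :=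
  (@lebesgue_measure R \x @lebesgue_measure R)%E.

(* Lebesgue measure on R^2, defined on the sigma-algebra of all Lebesgue
   measurable sets: the product measure is only defined on Borel sets and is
   completed here by Caratheodory's construction. *)
Notation plane := (caratheodory_type (mu_ext borel_measure2)).

Definition lebesgue_measure2 : set plane -> \bar R :=
  @completed_measure_extension _ _ _ borel_measure2.
HB.instance Definition _ := Measure.on lebesgue_measure2.

Definition quat_Lp (p : \bar R) (f : R * R -> quat R) : Prop :=
  [/\ measurable_fun [set: plane] (fun x : plane => q0 (f x)),
      measurable_fun [set: plane] (fun x : plane => q1 (f x)),
      measurable_fun [set: plane] (fun x : plane => q2 (f x)),
      measurable_fun [set: plane] (fun x : plane => q3 (f x)) &
      (fun x : plane => quat_norm (f x)) \in Lfun lebesgue_measure2 p].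

Definition quat_integral (f : R * R -> quat R) : quat R :=
  Quat (\int[lebesgue_measure2]_x q0 (f x))
       (\int[lebesgue_measure2]_x q1 (f x))
       (\int[lebesgue_measure2]_x q2 (f x))
       (\int[lebesgue_measure2]_x q3 (f x)).

End plane.

Record qp_param (R : Type) :=
  QPParam { qpa : R; qpb : R; qpc : R; qpd : R; qpe : R }.

Section transform.
Variable R : realType.
Implicit Types (m : qp_param R) (f : R * R -> quat R).

(* complex.sqrtc is the principal square root; Num's sqrtC is not, as it
   always has a nonnegative imaginary part. *)
Definition qp_kernel m (x w : R) : R[i] :=
  sqrtc (Complex 0 (qpb m / (2 * pi))) *
  cexpi (- (qpa m * x ^+ 2 + qpb m * x * w + qpc m * w ^+ 2
            + qpd m * x + qpe m * w)).

Definition qp_kernel_i m (x w : R) : quat R := in_Ci (qp_kernel m x w).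
Definition qp_kernel_j m (x w : R) : quat R := in_Cj (qp_kernel m x w).

Definition qqpft m1 m2 f (w : R * R) : quat R :=
  quat_integral (fun x =>
    qp_kernel_i m1 x.1 w.1 * f x * qp_kernel_j m2 x.2 w.2).

Definition qmodulation (w : R * R) f (x : R * R) : quat R :=
  qexpi (x.1 * w.1) * f x * qexpj (x.2 * w.2).

End transform.

(* Main.v *)
(** Since [b x (w - u/b) = b x w - x u], modulating [f] by [exp (i x u)] shifts
    [w] by [u/b] in the kernel, up to a phase which does not depend on [x].  The
    [i]-phase commutes with the left kernel and the [j]-phase with the right
    one, so both are constant outer factors of the integrand; they leave the
    integral because the kernels are bounded and [f] is integrable. *)
Require Import Defs.
From mathcomp Require Import all_boot all_order all_algebra.
From mathcomp Require Import all_classical all_reals all_analysis.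
From mathcomp Require Import measurable_realfun complex ring lra.

Set Implicit Arguments.
Unset Strict Implicit.
Unset Printing Implicit Defensive.

Import Order.TTheory GRing.Theory Num.Theory.
Import numFieldNormedType.Exports.
Local Open Scope ring_scope.

(** * Phase factors and the kernel in the complex planes *)

Section phases.
Variable R : realType.
Implicit Types (z : R[i]) (s t : R).

Lemma cexpiD s t : cexpi (s + t) = cexpi s * cexpi t.
Proof.
rewrite /cexpi cosD sinD; apply/eqP; rewrite eq_complex /=.
by apply/andP; split; apply/eqP; ring.
Qed.

Lemma in_CiM z1 z2 : in_Ci (z1 * z2) = in_Ci z1 * in_Ci z2.
Proof. by case: z1 z2 => [? ?] [? ?]; congr Quat => /=; ring. Qed.

Lemma in_CjM z1 z2 : in_Cj (z1 * z2) = in_Cj z1 * in_Cj z2.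
Proof. by case: z1 z2 => [? ?] [? ?]; congr Quat => /=; ring. Qed.

(** Replacing [w] by [w - u / b] turns [b x w] into [b x w - x u], which yields the modulation. It
    also changes [c w^2 + e w] by [(c u^2 - 2 b c u w - b e u) / b^2], and the outer phase
    compensates for this. *)
Lemma qp_kernel_modulation (a b c d e x u w : R) : b != 0 ->
  qp_kernel (QPParam a b c d e) x w * cexpi (x * u) =
  cexpi ((c * u ^+ 2 - 2 * b * c * u * w - b * e * u) / b ^+ 2)
    * qp_kernel (QPParam a b c d e) x (w - u / b).
Proof.
move=> b0; rewrite /qp_kernel; set z := sqrtc _.
rewrite [RHS]mulrCA -[LHS]mulrA -!cexpiD; congr (z * cexpi _) => /=.
by field.
Qed.

(** Since [|cos t|] and [|sin t|] are at most 1, the bound is uniform in [t]; this gives boundedness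
    of the kernels. *)
Lemma norm_components_phase_le z t :
  `|complex.Re (z * cexpi t)| <= `|complex.Re z| + `|complex.Im z| /\
  `|complex.Im (z * cexpi t)| <= `|complex.Re z| + `|complex.Im z|.
Proof.
have c1 : `|cos t| <= 1 by rewrite ler_norml cos_geN1 cos_le1.
have s1 : `|sin t| <= 1 by rewrite ler_norml sin_geN1 sin_le1.
case: z => p q /=; split.
  by rewrite (le_trans (ler_normB _ _))// !normrM lerD// ler_piMr.
by rewrite (le_trans (ler_normD _ _))// !normrM lerD// ler_piMr.
Qed.

(* Rewriting with these lemmas replaces conversion, which would unfold the
   operations of [R] under integrals. *)
Lemma q0M (p q : quat R) :
  q0 (p * q) = q0 p * q0 q - q1 p * q1 q - q2 p * q2 q - q3 p * q3 q.
Proof. by []. Qed.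

Lemma q1M (p q : quat R) :
  q1 (p * q) = q0 p * q1 q + q1 p * q0 q + q2 p * q3 q - q3 p * q2 q.
Proof. by []. Qed.

Lemma q2M (p q : quat R) :
  q2 (p * q) = q0 p * q2 q - q1 p * q3 q + q2 p * q0 q + q3 p * q1 q.
Proof. by []. Qed.

Lemma q3M (p q : quat R) :
  q3 (p * q) = q0 p * q3 q + q1 p * q2 q - q2 p * q1 q + q3 p * q0 q.
Proof. by []. Qed.

End phases.

(** * Integrability and linearity of the quaternion integral *)

Section plane_integral.
Variable R : realType.
Notation borel_measure2 :=
  (@lebesgue_measure R \x @lebesgue_measure R)%E.
Notation plane := (caratheodory_type (mu_ext borel_measure2)).
Notation mu := (@lebesgue_measure2 R).
Implicit Types (f g : plane -> R) (p h : R * R -> quat R).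

(** Borel sets are Caratheodory measurable for the outer measure induced by the product measure. *)
Lemma borel_measurable_plane (g : R * R -> R) :
  measurable_fun setT g -> measurable_fun [set: plane] g.
Proof.
move=> mg _ Y mY; rewrite setTI.
apply: caratheodory_measurable_mu_ext.
by rewrite -[X in measurable X]setTI; exact: mg.
Qed.

(** [quat_integral] is taken coordinate by coordinate, so analytic hypotheses are imposed in the
    same way. *)
Definition componentwise (P : (plane -> R) -> Prop) h :=
  [/\ P (fun x => q0 (h x)), P (fun x => q1 (h x)), P (fun x => q2 (h x))
    & P (fun x => q3 (h x))].

Definition mbounded f :=
  measurable_fun setT f /\ exists M, forall x, `|f x| <= M.

Definition rintegrable f := mu.-integrable setT (EFin \o f).

Lemma mbounded_cst k : mbounded (cst k).
Proof. by split; [exact: measurable_cst | exists `|k|]. Qed.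

Lemma rintegrableD f g :
  rintegrable f -> rintegrable g -> rintegrable (fun x => f x + g x).
Proof. exact: integrableD. Qed.

Lemma rintegrableB f g :
  rintegrable f -> rintegrable g -> rintegrable (fun x => f x - g x).
Proof. exact: integrableB. Qed.

Lemma rintegrableMl f g :
  mbounded f -> rintegrable g -> rintegrable (fun x => f x * g x).
Proof.
move=> [mf [M fM]] ig.
apply: (@integrableMr _ _ _ mu setT measurableT f _ mf _ ig).
(* Boundedness here means that every [N] above some real threshold is a bound; [M] is the
   threshold. *)
exists M; split=> [|N MN x _ /=]; first exact: num_real.
exact: le_trans (fM x) (ltW MN).
Qed.

Lemma rintegrableMr f g :
  mbounded g -> rintegrable f -> rintegrable (fun x => f x * g x).
Proof.
move=> bg if_; rewrite [X in rintegrable X](_ : _ = (fun x => g x * f x)).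
  exact: rintegrableMl.
by apply/funext => x; exact: mulrC.
Qed.

(** Each coordinate of the product is a signed sum of four products of a bounded and an integrable
    function. *)
Lemma quat_integrableMl p h : componentwise mbounded p ->
  componentwise rintegrable h ->
  componentwise rintegrable (fun x => p x * h x).
Proof.
move=> [p0 p1 p2 p3] [h0 h1 h2 h3]; have M := rintegrableMl; split.
- rewrite (funext (fun x => q0M (p x) (h x))).
  exact: (rintegrableB (rintegrableB (rintegrableB
    (M _ _ p0 h0) (M _ _ p1 h1))
    (M _ _ p2 h2)) (M _ _ p3 h3)).
- rewrite (funext (fun x => q1M (p x) (h x))).
  exact: (rintegrableB (rintegrableD (rintegrableD
    (M _ _ p0 h1) (M _ _ p1 h0))
    (M _ _ p2 h3)) (M _ _ p3 h2)).
- rewrite (funext (fun x => q2M (p x) (h x))).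
  exact: (rintegrableD (rintegrableD (rintegrableB
    (M _ _ p0 h2) (M _ _ p1 h3))
    (M _ _ p2 h0)) (M _ _ p3 h1)).
- rewrite (funext (fun x => q3M (p x) (h x))).
  exact: (rintegrableD (rintegrableB (rintegrableD
    (M _ _ p0 h3) (M _ _ p1 h2))
    (M _ _ p2 h1)) (M _ _ p3 h0)).
Qed.

Lemma quat_integrableMr p h : componentwise mbounded p ->
  componentwise rintegrable h ->
  componentwise rintegrable (fun x => h x * p x).
Proof.
move=> [p0 p1 p2 p3] [h0 h1 h2 h3]; have M := rintegrableMr; split.
- rewrite (funext (fun x => q0M (h x) (p x))).
  exact: (rintegrableB (rintegrableB (rintegrableB
    (M _ _ p0 h0) (M _ _ p1 h1))
    (M _ _ p2 h2)) (M _ _ p3 h3)).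
- rewrite (funext (fun x => q1M (h x) (p x))).
  exact: (rintegrableB (rintegrableD (rintegrableD
    (M _ _ p1 h0) (M _ _ p0 h1))
    (M _ _ p3 h2)) (M _ _ p2 h3)).
- rewrite (funext (fun x => q2M (h x) (p x))).
  exact: (rintegrableD (rintegrableD (rintegrableB
    (M _ _ p2 h0) (M _ _ p3 h1))
    (M _ _ p0 h2)) (M _ _ p1 h3)).
- rewrite (funext (fun x => q3M (h x) (p x))).
  exact: (rintegrableD (rintegrableB (rintegrableD
    (M _ _ p3 h0) (M _ _ p2 h1))
    (M _ _ p1 h2)) (M _ _ p0 h3)).
Qed.

Lemma rintegrableZ a f : rintegrable f -> rintegrable (fun x => a * f x).
Proof. exact: rintegrableMl (mbounded_cst a). Qed.

Lemma Rintegral_lincomb4 (a b c d : R) f g f' g' :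
  rintegrable f -> rintegrable g -> rintegrable f' -> rintegrable g' ->
  \int[mu]_x (a * f x + b * g x + c * f' x + d * g' x) =
  a * \int[mu]_x f x + b * \int[mu]_x g x +
  c * \int[mu]_x f' x + d * \int[mu]_x g' x.
Proof.
move=> if_ ig if' ig'.
have [ia ib ic id] := And4 (rintegrableZ a if_) (rintegrableZ b ig)
  (rintegrableZ c if') (rintegrableZ d ig').
have iab := rintegrableD ia ib; have iabc := rintegrableD iab ic.
rewrite (RintegralD measurableT iabc id) (RintegralD measurableT iab ic).
by rewrite (RintegralD measurableT ia ib) !RintegralZl.
Qed.

(** Left multiplication by [k] is a real linear map of the four coordinates, so each coordinate is a
    real linear combination of four integrals. *)
Lemma quat_integralMl (k : quat R) h : componentwise rintegrable h ->
  quat_integral (fun x => k * h x) = k * quat_integral h.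
Proof.
move=> [h0 h1 h2 h3]; congr Quat.
- apply: etrans (etrans (Rintegral_lincomb4
    (q0 k) (- q1 k) (- q2 k) (- q3 k) h0 h1 h2 h3) _).
    by apply: eq_Rintegral => x _; rewrite q0M; ring.
  by rewrite /=; ring.
- apply: etrans (etrans (Rintegral_lincomb4
    (q0 k) (q1 k) (q2 k) (- q3 k) h1 h0 h3 h2) _).
    by apply: eq_Rintegral => x _; rewrite q1M; ring.
  by rewrite /=; ring.
- apply: etrans (etrans (Rintegral_lincomb4
    (q0 k) (- q1 k) (q2 k) (q3 k) h2 h3 h0 h1) _).
    by apply: eq_Rintegral => x _; rewrite q2M; ring.
  by rewrite /=; ring.
- apply: etrans (etrans (Rintegral_lincomb4
    (q0 k) (q1 k) (- q2 k) (q3 k) h3 h2 h1 h0) _).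
    by apply: eq_Rintegral => x _; rewrite q3M; ring.
  by rewrite /=; ring.
Qed.

Lemma quat_integralMr (k : quat R) h : componentwise rintegrable h ->
  quat_integral (fun x => h x * k) = quat_integral h * k.
Proof.
move=> [h0 h1 h2 h3]; congr Quat.
- apply: etrans (etrans (Rintegral_lincomb4
    (q0 k) (- q1 k) (- q2 k) (- q3 k) h0 h1 h2 h3) _).
    by apply: eq_Rintegral => x _; rewrite q0M; ring.
  by rewrite /=; ring.
- apply: etrans (etrans (Rintegral_lincomb4
    (q1 k) (q0 k) (q3 k) (- q2 k) h0 h1 h2 h3) _).
    by apply: eq_Rintegral => x _; rewrite q1M; ring.
  by rewrite /=; ring.
- apply: etrans (etrans (Rintegral_lincomb4
    (q2 k) (- q3 k) (q0 k) (q1 k) h0 h1 h2 h3) _).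
    by apply: eq_Rintegral => x _; rewrite q2M; ring.
  by rewrite /=; ring.
- apply: etrans (etrans (Rintegral_lincomb4
    (q3 k) (q2 k) (- q1 k) (q0 k) h0 h1 h2 h3) _).
    by apply: eq_Rintegral => x _; rewrite q3M; ring.
  by rewrite /=; ring.
Qed.

(** Each coordinate is dominated by the integrable norm; the comparison is made on squares to remove
    the square root. *)
Lemma quat_Lp1_integrable h : quat_Lp 1%E h -> componentwise rintegrable h.
Proof.
move=> [m0 m1 m2 m3 /Lfun1_integrable hi].
have dom g : measurable_fun setT g ->
    (forall x, g x ^+ 2 <= quat_norm (h x) ^+ 2) -> rintegrable g.
  move=> mg gle; apply: (le_integrable measurableT _ _ hi).
    exact/measurable_EFinP.
  move=> x _; rewrite /= lee_fin.
  by rewrite -ler_sqr ?nnegrE// !real_normK ?num_real.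
have sqr4 x : quat_norm (h x) ^+ 2 =
    q0 (h x) ^+ 2 + q1 (h x) ^+ 2 + q2 (h x) ^+ 2 + q3 (h x) ^+ 2.
  by rewrite sqr_sqrtr// !addr_ge0// sqr_ge0.
by split; apply: dom => // x; rewrite sqr4 /=;
  have := sqr_ge0 (q0 (h x)); have := sqr_ge0 (q1 (h x));
  have := sqr_ge0 (q2 (h x)); have := sqr_ge0 (q3 (h x)); lra.
Qed.

Lemma mbounded_phase (z : R[i]) (phi : R * R -> R) : measurable_fun setT phi ->
  mbounded (fun x => complex.Re (z * cexpi (phi x))) /\
  mbounded (fun x => complex.Im (z * cexpi (phi x))).
Proof.
move=> mphi.
have mcos : measurable_fun setT (fun x => cos (phi x)).
  apply: measurableT_comp mphi.
  exact: continuous_measurable_fun (@continuous_cos R).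
have msin : measurable_fun setT (fun x => sin (phi x)).
  apply: measurableT_comp mphi.
  exact: continuous_measurable_fun (@continuous_sin R).
split; split.
- apply: borel_measurable_plane; case: z => p q /=.
  by apply: measurable_funB; apply: measurable_funM => //;
    exact: measurable_cst.
- by exists (`|complex.Re z| + `|complex.Im z|) => x;
    exact: (norm_components_phase_le z (phi x)).1.
- apply: borel_measurable_plane; case: z => p q /=.
  by apply: measurable_funD; apply: measurable_funM => //;
    exact: measurable_cst.
- by exists (`|complex.Re z| + `|complex.Im z|) => x;
    exact: (norm_components_phase_le z (phi x)).2.
Qed.

Lemma mbounded_qp_kernel (m : qp_param R) (w : R) (xi : R * R -> R) :
  measurable_fun setT xi ->
  mbounded (fun x => complex.Re (qp_kernel m (xi x) w)) /\
  mbounded (fun x => complex.Im (qp_kernel m (xi x) w)).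
Proof.
move=> mxi; apply: mbounded_phase.
apply: measurableT_comp => //.
by repeat apply: measurable_funD => //; repeat apply: measurable_funM => //;
  exact: measurable_cst.
Qed.

Lemma mbounded_qp_kernel_i (m : qp_param R) (w : R) :
  componentwise mbounded (fun x => qp_kernel_i m x.1 w).
Proof.
have [bre bim] := mbounded_qp_kernel m w (@measurable_fst _ _ _ _).
(* The coordinates outside the plane of [i] vanish identically. *)
by split=> //; exact: (mbounded_cst 0).
Qed.

Lemma mbounded_qp_kernel_j (m : qp_param R) (w : R) :
  componentwise mbounded (fun x => qp_kernel_j m x.2 w).
Proof.
have [bre bim] := mbounded_qp_kernel m w (@measurable_snd _ _ _ _).
by split=> //; exact: (mbounded_cst 0).
Qed.

End plane_integral.

Theorem theorem3p9 (R : realType)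
    (a1 b1 c1 d1 e1 a2 b2 c2 d2 e2 : R) (hb1 : b1 != 0) (hb2 : b2 != 0)
    (f : R * R -> quat R) (hf : quat_Lp 1%E f) (u0 v0 : R) :
  let mu1 := QPParam a1 b1 c1 d1 e1 in
  let mu2 := QPParam a2 b2 c2 d2 e2 in
  forall w1 w2 : R,
    qqpft mu1 mu2 (qmodulation (u0, v0) f) (w1, w2) =
      qexpi ((c1 * u0 ^+ 2 - 2 * b1 * c1 * u0 * w1 - b1 * e1 * u0) / b1 ^+ 2)
      * qqpft mu1 mu2 f (w1 - u0 / b1, w2 - v0 / b2)
      * qexpj ((c2 * v0 ^+ 2 - 2 * b2 * c2 * v0 * w2 - b2 * e2 * v0) / b2 ^+ 2).
Proof.
move=> mu1 mu2 w1 w2; rewrite /qqpft /qmodulation /qexpi /qexpj.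
set A := in_Ci _; set B := in_Cj _.
have iK : componentwise (@rintegrable R) (fun x =>
    qp_kernel_i mu1 x.1 (w1 - u0 / b1) * f x
    * qp_kernel_j mu2 x.2 (w2 - v0 / b2)).
  apply: quat_integrableMr; first exact: mbounded_qp_kernel_j.
  apply: quat_integrableMl; first exact: mbounded_qp_kernel_i.
  exact: quat_Lp1_integrable.
(* [B] is absorbed after [A], so linearity on the right is applied to an integrand that already
   contains [A]. *)
have iAK : componentwise (@rintegrable R) (fun x =>
    A * (qp_kernel_i mu1 x.1 (w1 - u0 / b1) * f x
    * qp_kernel_j mu2 x.2 (w2 - v0 / b2))).
  by apply: (@quat_integrableMl _ (cst A)) => //; split; exact: mbounded_cst.
rewrite -(quat_integralMl A iK) -(quat_integralMr B iAK).
(* With both phases under the integral, a pointwise identity of integrands remains. *)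
congr quat_integral; apply/funext => x /=.
have EI : qp_kernel_i mu1 x.1 w1 * in_Ci (cexpi (x.1 * u0)) =
    A * qp_kernel_i mu1 x.1 (w1 - u0 / b1).
  by rewrite -in_CiM qp_kernel_modulation// in_CiM.
(* The factors are commuted as complex numbers, before embedding, so that [B] ends on the far
   right. *)
have EJ : in_Cj (cexpi (x.2 * v0)) * qp_kernel_j mu2 x.2 w2 =
    qp_kernel_j mu2 x.2 (w2 - v0 / b2) * B.
  rewrite -in_CjM [_ * qp_kernel _ _ _]mulrC qp_kernel_modulation//.
  by rewrite mulrC in_CjM.
by rewrite !mulrA EI -[LHS]mulrA EJ !mulrA.
Qed.
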